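(* Assume the strong-inclusion case, i.e. $(\lambda_{\mathcal{D}_{\min}},\mu_{\mathcal{D}_{\min}})>(\lambda_{\mathcal{B}_{\max}},\mu_{\mathcal{B}_{\max}})$ componentwise, and that admissible data satisfy $(\lambda_{\mathcal D}(x)-\lambda_0,\mu_{\mathcal D}(x)-\mu_0)\ge (c^\lambda,c^\mu)$ for all $x\in\mathcal D$, as well as $\lambda(x)\le\lambda_{\max}$ and $\mu(x)\le\mu_{\max}$ for all $x\in\Omega$, with known constants $\lambda_{\max},\mu_{\max}$. Set $$\kappa^{\lambda}:=(c^{\lambda}+\lambda_0\epsilon^\lambda)\frac{\lambda_{\mathcal{B}_{\min}}}{\lambda_{\max}},\qquad \kappa^{\mu}:=(c^{\mu}+\mu_0\epsilon^\mu)\frac{\mu_{\mathcal{B}_{\min}}}{\mu_{\max}},$$ and for $s=1,\dots,N$ $$\mathbf T_s:=\boldsymbol\Lambda(\lambda_{\mathcal{B}_{\min}},\mu_{\mathcal{B}_{\min}})+\boldsymbol\Lambda'(\lambda_{\mathcal{B}_{\min}},\mu_{\mathcal{B}_{\min}})(\kappa^\lambda\chi_{\omega_s},\kappa^\mu\chi_{\omega_s}).$$ Consider the reconstruction method which marks each $\omega_s$, $s\in\{1,\dots,N\}$, for which $$\mathbf T_s+\delta\mathbf I\ \ge\ \boldsymbol\Lambda^\delta(\lambda,\mu),$$ and defines the reconstruction $\mathcal D_R$ as the union of all marked $\omega_s$. Let $$\nu:=\max_{s=1,\dots,N}\Big(\min\big(\mathrm{eig}\big[\mathbf T_s-\boldsymbol\Lambda(\lambda_{\mathcal{B}_{\max}},\mu_{\mathcal{B}_{\max}})\big]\big)\Big).$$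 If $\nu<-2\delta\le0$, then this method fulfills the resolution guarantee with respect to the partition $(\omega_s)_{s=1,\dots,N}$.
   Context: Domain and partition. $\Omega\subset\mathbb R^d$ ($d=2$ or $3$) is a bounded connected open set with Lipschitz, piecewise smooth boundary $\partial\Omega=\overline{\Gamma_{\mathrm D}\cup\Gamma_{\mathrm N}}$, where $\Gamma_{\mathrm D},\Gamma_{\mathrm N}$ are disjoint, nonempty, relatively open and connected. $(\omega_s)_{s=1,\dots,N}$ are disjoint open subsets of $\Omega$ with $\overline\Omega=\bigcup_{s}\overline{\omega_s}$. $\chi_A$ is the characteristic function of $A$. Elasticity problem and measurements. $L^\infty_+(\Omega)=\{w\in L^\infty(\Omega):\operatorname{ess\,inf} w>0\}$, $\hat\nabla u=\frac12(\nabla u+(\nabla u)^T)$, $\mathcal V=\{v\in H^1(\Omega)^d: v|_{\Gamma_{\mathrm D}}=0\}$. Let $\Gamma_{\mathrm N}^{(l)}\subseteq\Gamma_{\mathrm N}$, $l=1,\dots,M$, be disjoint patches and $g_l\in L^2(\Gamma_{\mathrm N})^d$ boundary forces supported in $\Gamma_{\mathrm N}^{(l)}$. For $\lambda,\mu\in L^\infty_+(\Omega)$ let $u^{(k)}=u^{(k)}_{(\lambda,\mu)}\in\mathcal V$ be the unique solution of $$\int_\Omega 2\mu\,\hat\nabla u^{(k)}:\hat\nabla v+\lambda\,(\nabla\cdot u^{(k)})(\nabla\cdot v)\,dx=\int_{\Gamma_{\mathrm N}}g_k\cdot v\,ds\quad\text{for all }v\in\mathcal V$$ (the weak form of $\nabla\cdot(\lambda(\nabla\cdot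 u)I+2\mu\hat\nabla u)=0$ in $\Omega$, with traction $g_k$ on $\Gamma_{\mathrm N}^{(k)}$, zero traction on the rest of $\Gamma_{\mathrm N}$, and $u=0$ on $\Gamma_{\mathrm D}$). The discrete Neumann-to-Dirichlet matrix is the symmetric $M\times M$ matrix $\boldsymbol\Lambda(\lambda,\mu)=(\Lambda_l^{(k)}(\lambda,\mu))_{k,l=1,\dots,M}$ with $\Lambda_l^{(k)}(\lambda,\mu)=\int_{\Gamma_{\mathrm N}^{(l)}}g_l\cdot u^{(k)}\,ds$. Its (Fréchet) derivative in direction $(\hat\lambda,\hat\mu)\in L^\infty(\Omega)^2$ is the symmetric $M\times M$ matrix $\boldsymbol\Lambda'(\lambda,\mu)(\hat\lambda,\hat\mu)$ with entries $$-\int_\Omega 2\hat\mu\,\hat\nabla u^{(k)}_{(\lambda,\mu)}:\hat\nabla u^{(l)}_{(\lambda,\mu)}+\hat\lambda\,(\nabla\cdot u^{(k)}_{(\lambda,\mu)})(\nabla\cdot u^{(l)}_{(\lambda,\mu)})\,dx,\qquad k,l=1,\dots,M.$$ Known constants. $\lambda_0,\mu_0>0$ (approximate background values), background errors $\epsilon^\lambda,\epsilon^\mu\ge0$, contrast bounds $c^\lambda,c^\mu>0$, upper bounds $\lambda_{\max},\mu_{\max}>0$, noise level $\delta\ge0$. Set $(\lambda_{\mathcal{B}_{\min}},\mu_{\mathcal{B}_{\min}})=(\lambda_0(1-\epsilon^\lambda),\mu_0(1-\epsilon^\mu))$, $(\lambda_{\mathcal{B}_{\max}},\mu_{\mathcal{B}_{\max}})=(\lambda_0(1+\epsilon^\lambda),\mu_0(1+\epsilon^\mu))$,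 $(\lambda_{\mathcal{D}_{\min}},\mu_{\mathcal{D}_{\min}})=(\lambda_0+c^\lambda,\mu_0+c^\mu)$. It is assumed that $\lambda_{\mathcal{B}_{\min}},\mu_{\mathcal{B}_{\min}}>0$. Admissible data. These consist of a (measurable, unknown) inclusion $\mathcal D\subseteq\Omega$, Lamé parameters $\lambda,\mu\in L^\infty_+(\Omega)$ with $(\lambda,\mu)=(\lambda_{\mathcal D},\mu_{\mathcal D})$ on $\mathcal D$ and $(\lambda,\mu)=(\lambda_{\mathcal B},\mu_{\mathcal B})$ on $\Omega\setminus\mathcal D$, where $|\lambda_{\mathcal B}(x)-\lambda_0|\le\lambda_0\epsilon^\lambda$ and $|\mu_{\mathcal B}(x)-\mu_0|\le\mu_0\epsilon^\mu$ for all $x\in\Omega\setminus\mathcal D$, where the contrast condition and upper bounds stated in the claim hold, and a noisy matrix $\boldsymbol\Lambda^\delta(\lambda,\mu)\in\mathbb R^{M\times M}$ with $\|\boldsymbol\Lambda(\lambda,\mu)-\boldsymbol\Lambda^\delta(\lambda,\mu)\|\le\delta$ (spectral norm). Conventions. For matrices, $A\ge B$ means $x^TAx\ge x^TBx$ for all $x\in\mathbb R^M$; inequalities between pairs of parameters are componentwise; $\mathrm{eig}[A]$ is the set of eigenvalues of $A$; $\mathbf I$ is the $M\times M$ identity matrix. Resolution guarantee. A method producing from the data a reconstruction $\mathcal D_R$ of $\mathcal D$ fulfills the resolution guarantee w.r.t. $(\omega_s)_{s=1,\dots,N}$ if for all admissible data: (i) $\omega_s\subseteq\mathcal D$ implies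 $\omega_s\subseteq\mathcal D_R$ for every $s\in\{1,\dots,N\}$; and (ii) $\mathcal D=\emptyset$ implies $\mathcal D_R=\emptyset$. *)

(* Defs.v *)
From HB Require Import structures.
From mathcomp Require Import all_boot all_order all_algebra.
From mathcomp Require Import all_classical all_reals all_analysis.

Set Implicit Arguments.
Unset Strict Implicit.
Unset Printing Implicit Defensive.

Import Order.TTheory GRing.Theory Num.Theory.
Import numFieldNormedType.Exports.

Local Open Scope classical_set_scope.
Local Open Scope ring_scope.

(* Points of R^d are row vectors.  The library norm on 'rV[R]_d is the sup
   norm (it induces the usual topology); every metric notion below uses the
   Euclidean norm enorm instead. *)

Section Euclidean.
Context {R : realType} {d : nat}.
Implicit Types (x y : 'rV[R]_d) (A B : 'M[R]_d) (S : set 'rV[R]_d).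

Definition dot x y : R := \sum_i x 0 i * y 0 i.
Definition enorm x : R := Num.sqrt (dot x x).
Definition frob A B : R := \sum_i \sum_j A i j * B i j.
Definition boundary S : set 'rV[R]_d := closure S `\` S°.
Definition diam S : \bar R :=
  ereal_sup [set (enorm (p.1 - p.2))%:E | p in S `*` S].

End Euclidean.

(* Outer measures generated by a gauge: [allsets T] is T with every subset
   measurable, so that the library's [mu_ext tau] is the infimum of
   \sum_k tau (A_k) over all countable covers (A_k) by arbitrary sets. *)

Definition allsets (T : Type) : Type := T.

Section Allsets.
Variable T : pointedType.
HB.instance Definition _ := Pointed.on (allsets T).
Let all_set0 : [set: set (allsets T)] set0. Proof. by []. Qed.
Let all_setC (A : set (allsets T)) :
  [set: set (allsets T)] A -> [set: set (allsets T)] (~` A).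
Proof. by []. Qed.
Let all_bigcup (F : (set (allsets T))^nat) :
  (forall i, [set: set (allsets T)] (F i)) ->
  [set: set (allsets T)] (\bigcup_i F i).
Proof. by []. Qed.
HB.instance Definition _ := @isMeasurable.Build default_measure_display
  (allsets T) [set: set (allsets T)] all_set0 all_setC all_bigcup.
End Allsets.

Section LebesgueMeasure.
Context (R : realType) (d : nat).
Local Open Scope ereal_scope.

(* volume of the smallest closed box containing A *)
Definition box_gauge (A : set (allsets 'rV[R]_d)) : \bar R :=
  if A == set0 then 0 else
  ereal_inf [set (\prod_i (p.2 0 i - p.1 0 i))%R%:E | p in
    [set p : 'rV[R]_d * 'rV[R]_d |
      (forall i, p.1 0 i <= p.2 0 i)%R /\
      A `<=` [set x : 'rV[R]_d | forall i, (p.1 0 i <= x 0 i <= p.2 0 i)%R]]].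

Lemma box_gauge0 : box_gauge set0 = 0.
Proof. by rewrite /box_gauge eqxx. Qed.

Lemma box_gauge_ge0 A : 0 <= box_gauge A.
Proof.
rewrite /box_gauge; case: ifP => // _.
apply: le_ereal_inf_tmp => _ [p [p12 _] <-]; rewrite lee_fin.
by apply: prodr_ge0 => i _; rewrite subr_ge0.
Qed.

Definition lebesgue_outer (A : set 'rV[R]_d) : \bar R := mu_ext box_gauge A.

HB.instance Definition _ := isOuterMeasure.Build R 'rV[R]_d lebesgue_outer
  (mu_ext0 box_gauge0 box_gauge_ge0) (mu_ext_ge0 box_gauge_ge0)
  (le_mu_ext box_gauge) (mu_ext_sigma_subadditive box_gauge_ge0).

Definition lebesgue_om : {outer_measure set 'rV[R]_d -> \bar R} := lebesgue_outer.

Definition Leb : {measure set (caratheodory_type lebesgue_outer) -> \bar R} :=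
  (lebesgue_om : set (caratheodory_type lebesgue_om) -> \bar R).

End LebesgueMeasure.

Section HausdorffMeasure.
Context (R : realType) (d n : nat).
Local Open Scope ereal_scope.

(* The factor, the volume of an n-dimensional ball of diameter 1, makes the
   n-dimensional Hausdorff measure agree with n-dimensional area. *)
Definition diam_gauge (r : R) (A : set (allsets 'rV[R]_d)) : \bar R :=
  if A == set0 then 0 else
  if diam (A : set 'rV[R]_d) <= r%:E then
    lebesgue_outer [set x : 'rV[R]_n | (enorm x <= 2^-1)%R] *
    (fine (diam (A : set 'rV[R]_d)) ^+ n)%R%:E
  else +oo.

Lemma diam_gauge0 r : diam_gauge r set0 = 0.
Proof. by rewrite /diam_gauge eqxx. Qed.

Lemma diam_gauge_ge0 r A : 0 <= diam_gauge r A.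
Proof.
rewrite /diam_gauge; case: ifPn => // /set0P[x Ax]; case: ifP => _ //.
apply: mule_ge0; first exact: outer_measure_ge0.
rewrite lee_fin exprn_ge0// fine_ge0//; apply: ereal_sup_ubound.
exists (x, x) => //=; rewrite subrr /enorm /dot big1 ?sqrtr0// => i _.
by rewrite mxE mul0r.
Qed.

Definition hausdorff_outer (A : set 'rV[R]_d) : \bar R :=
  ereal_sup [set mu_ext (diam_gauge r) A | r in [set r : R | (0 < r)%R]].

Lemma hausdorff_pre_le r A : (0 < r)%R -> mu_ext (diam_gauge r) A <= hausdorff_outer A.
Proof. by move=> r0; apply: ereal_sup_ubound; exists r. Qed.

Lemma hausdorff0 : hausdorff_outer set0 = 0.
Proof.
rewrite /hausdorff_outer (_ : image _ _ = [set 0]) ?ereal_sup1//.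
apply/seteqP; split => [_ [r _ <-]|_ ->] /=.
  by rewrite mu_ext0//; [exact: diam_gauge0|exact: diam_gauge_ge0].
exists 1%R => //=.
by rewrite mu_ext0//; [exact: diam_gauge0|exact: diam_gauge_ge0].
Qed.

Lemma hausdorff_ge0 A : 0 <= hausdorff_outer A.
Proof.
by apply: (le_trans _ (hausdorff_pre_le A ltr01)); apply: mu_ext_ge0; exact: diam_gauge_ge0.
Qed.

Lemma le_hausdorff : {homo hausdorff_outer : A B / A `<=` B >-> A <= B}.
Proof.
move=> A B AB; apply: ge_ereal_sup => _ [r r0 <-].
by apply: (le_trans _ (hausdorff_pre_le B r0)); exact: le_mu_ext.
Qed.

Lemma hausdorff_subadditive : sigma_subadditive hausdorff_outer.
Proof.
move=> F; apply: ge_ereal_sup => _ [r r0 <-].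
apply: (le_trans (mu_ext_sigma_subadditive (diam_gauge_ge0 r) F)).
apply: lee_nneseries => i _; last exact: hausdorff_pre_le.
by move=> _; apply: mu_ext_ge0; exact: diam_gauge_ge0.
Qed.

HB.instance Definition _ := isOuterMeasure.Build R 'rV[R]_d hausdorff_outer
  hausdorff0 hausdorff_ge0 le_hausdorff hausdorff_subadditive.

Definition hausdorff_om : {outer_measure set 'rV[R]_d -> \bar R} := hausdorff_outer.

Definition Hausdorff :
  {measure set (caratheodory_type hausdorff_outer) -> \bar R} :=
  (hausdorff_om : set (caratheodory_type hausdorff_om) -> \bar R).

End HausdorffMeasure.

Definition surf (R : realType) (d : nat) := Hausdorff R d d.-1.

Section FunctionSpaces.
Context {R : realType} {d : nat}.
Local Notation Rd := 'rV[R]_d.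
Implicit Types (Omega S : set Rd) (phi w : Rd -> R) (v : Rd -> Rd).

Definition partial (j : 'I_d) phi : Rd -> R :=
  fun x => derive phi x (delta_mx 0 j).

Definition smooth phi := forall s : seq 'I_d,
  continuous (foldr partial phi s) /\
  forall j x, derivable (foldr partial phi s) x (delta_mx 0 j).

Definition test_function Omega phi := smooth phi /\
  exists K, [/\ compact K, K `<=` Omega & forall x, ~ K x -> phi x = 0].

Definition L2 (dd : measure_display) (T : measurableType dd)
    (m : {measure set T -> \bar R}) (A : set T) (f : T -> R) :=
  measurable_fun A f /\ m.-integrable A (fun x => (f x ^+ 2)%:E).

Definition Linf Omega w :=
  measurable_fun (Omega : set (caratheodory_type (@lebesgue_outer R d))) w /\
  exists C, {ae @Leb R d, forall x, Omega x -> `|w x| <= C}.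

Definition essinf Omega w : \bar R :=
  ereal_sup [set y | {ae @Leb R d, forall x, Omega x -> (y <= (w x)%:E)%E}].

Definition Linf_pos Omega w := Linf Omega w /\ (0 < essinf Omega w)%E.

(* G x i j represents the weak derivative d v_i / d x_j at x. *)
Definition weak_jacobian Omega v (G : Rd -> 'M[R]_d) :=
  forall i j phi, test_function Omega phi ->
    \int[@Leb R d]_(x in Omega) (v x 0 i * partial j phi x) =
    - \int[@Leb R d]_(x in Omega) (G x i j * phi x).

(* The trace is the continuous extension of restriction to the boundary,
   from smooth functions (dense in H^1 of a Lipschitz domain) to H^1.  The
   integrals are extended-real valued, so that convergence to 0 cannot hold
   through the junk value of a divergent real integral. *)
Definition boundary_trace Omega v (G : Rd -> 'M[R]_d) (t : Rd -> Rd) :=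
  forall i, exists phi : nat -> Rd -> R,
  [/\ forall n, smooth (phi n),
      (\int[@Leb R d]_(x in Omega) ((phi n x - v x 0 i) ^+ 2)%:E
        @[n --> \oo] --> 0)%E,
      forall j, (\int[@Leb R d]_(x in Omega)
          ((partial j (phi n) x - G x i j) ^+ 2)%:E @[n --> \oo] --> 0)%E
    & (\int[@surf R d]_(x in boundary Omega) ((phi n x - t x 0 i) ^+ 2)%:E
        @[n --> \oo] --> 0)%E].

(* An element of H^1(Omega)^d, together with representatives of its weak
   Jacobian and of its boundary trace (both are determined a.e. by fn, and
   exist for every H^1 function when Omega is a bounded Lipschitz domain). *)
Record H1 Omega := MkH1 {
  fn :> Rd -> Rd;
  jac : Rd -> 'M[R]_d;
  trace : Rd -> Rd;
  fnL2 : forall i, L2 (@Leb R d) Omega (fun x => fn x 0 i);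
  jacL2 : forall i j, L2 (@Leb R d) Omega (fun x => jac x i j);
  traceL2 : forall i, L2 (@surf R d) (boundary Omega) (fun x => trace x 0 i);
  jacP : weak_jacobian Omega fn jac;
  traceP : boundary_trace Omega fn jac trace }.

Definition symgrad Omega (v : H1 Omega) (x : Rd) : 'M[R]_d :=
  2^-1 *: (jac v x + (jac v x)^T).

Definition divergence Omega (v : H1 Omega) (x : Rd) : R := \tr (jac v x).

Definition vanishes_on Omega S (v : H1 Omega) :=
  {ae @surf R d, forall x, S x -> trace v x = 0}.

End FunctionSpaces.

Section Domain.
Context {R : realType} {d : nat}.
Local Notation Rd := 'rV[R]_d.
Implicit Types (Omega S T : set Rd).

Definition relatively_open T S := exists2 U, open U & S = T `&` U.

(* Near each boundary point, Omega is the part of space above the graph of a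
   Lipschitz function gam, in direction e.  Only the values of gam on the
   hyperplane orthogonal to e matter. *)
Definition lipschitz_boundary Omega := forall x, boundary Omega x ->
  exists (e : Rd) (gam : Rd -> R) (L r : R),
  [/\ enorm e = 1, 0 < r,
      forall y z, `|gam y - gam z| <= L * enorm (y - z)
    & forall y, enorm (y - x) < r ->
        (Omega y <-> gam (y - dot y e *: e) < dot y e)].

Definition smooth_hypersurface S := forall x, S x ->
  exists U (phi : Rd -> R), [/\ open U, U x, smooth phi,
    exists j, partial j phi x != 0 & S `&` U = [set y | phi y = 0] `&` U].

Definition piecewise_smooth_boundary Omega :=
  exists (n : nat) (S : 'I_n -> set Rd),
  [/\ forall i, relatively_open (boundary Omega) (S i) /\
        smooth_hypersurface (S i),
      trivIset setT S,
      boundary Omega = \bigcup_i closure (S i)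
    & surf R d (boundary Omega `\` \bigcup_i S i) = 0%E].

Definition elastic_body Omega GammaD GammaN :=
  [/\ [/\ bounded_set Omega, connected Omega & open Omega],
      lipschitz_boundary Omega, piecewise_smooth_boundary Omega
    & [/\ [/\ GammaD !=set0, relatively_open (boundary Omega) GammaD
            & connected GammaD],
          [/\ GammaN !=set0, relatively_open (boundary Omega) GammaN
            & connected GammaN],
          GammaD `&` GammaN = set0
        & boundary Omega = closure (GammaD `|` GammaN)]].

Definition pixel_partition Omega (N : nat) (omega : 'I_N -> set Rd) :=
  [/\ forall s, open (omega s) /\ omega s `<=` Omega,
      trivIset setT omega
    & closure Omega = \bigcup_s closure (omega s)].

End Domain.

Section Elasticity.
Context {R : realType} {d M : nat}.
Local Notation Rd := 'rV[R]_d.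
Variables (Omega GammaD GammaN : set Rd).
Implicit Types (lam mu : Rd -> R) (g : 'I_M -> Rd -> Rd) (P : 'I_M -> set Rd).

Definition boundary_loads P g :=
  [/\ forall l, P l `<=` GammaN /\
        measurable (P l : set (caratheodory_type (@hausdorff_outer R d d.-1))),
      trivIset setT P,
      forall l i, L2 (@surf R d) GammaN (fun x => g l x 0 i)
    & forall l, {ae @surf R d, forall x, GammaN x -> ~ P l x -> g l x = 0}].

Definition energy lam mu (v w : H1 Omega) : R :=
  \int[@Leb R d]_(x in Omega) (2 * mu x * frob (symgrad v x) (symgrad w x) +
    lam x * (divergence v x * divergence w x)).

Definition weak_solution lam mu (gk : Rd -> Rd) (u : H1 Omega) :=
  vanishes_on GammaD u /\
  forall v : H1 Omega, vanishes_on GammaD v ->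
    energy lam mu u v = \int[@surf R d]_(x in GammaN) dot (gk x) (trace v x).

(* u lam mu k is the displacement for the parameters (lam, mu), load g k. *)
Definition displacements g (u : (Rd -> R) -> (Rd -> R) -> 'I_M -> H1 Omega) :=
  forall lam mu, Linf_pos Omega lam -> Linf_pos Omega mu ->
  forall k, weak_solution lam mu (g k) (u lam mu k).

Definition NtD P g (u : 'I_M -> H1 Omega) : 'M[R]_M :=
  \matrix_(k, l) \int[@surf R d]_(x in P l) dot (g l x) (trace (u k) x).

(* derivative of the Neumann-to-Dirichlet matrix at the parameters whose
   displacements are u, in direction (hlam, hmu) *)
Definition dNtD (u : 'I_M -> H1 Omega) (hlam hmu : Rd -> R) : 'M[R]_M :=
  \matrix_(k, l) - energy hlam hmu (u k) (u l).

End Elasticity.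

Section Matrices.
Context {R : realType} {M : nat}.
Implicit Types A B : 'M[R]_M.

Definition mxge A B := forall x : 'cV[R]_M,
  (x^T *m B *m x) 0 0 <= (x^T *m A *m x) 0 0.

Definition spectral_norm A : R :=
  sup [set enorm (x *m A^T) | x in [set x : 'rV[R]_M | enorm x <= 1]].

(* The spectrum of a symmetric matrix of positive size is finite and nonempty,
   so this infimum is a minimum. *)
Definition min_eig A : R := inf [set a : R | eigenvalue A a].

End Matrices.

Section Resolution.
Context {R : realType} {d M : nat}.
Local Notation Rd := 'rV[R]_d.

Record constants := MkConstants {
  lam0 : R; mu0 : R;
  epsl : R; epsm : R;
  cl : R; cm : R;
  lam_max : R; mu_max : R;
  delta : R }.

Section Constants.
Variable K : constants.
Definition lamBmin := lam0 K * (1 - epsl K).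
Definition muBmin := mu0 K * (1 - epsm K).
Definition lamBmax := lam0 K * (1 + epsl K).
Definition muBmax := mu0 K * (1 + epsm K).
Definition lamDmin := lam0 K + cl K.
Definition muDmin := mu0 K + cm K.

Definition valid_constants :=
  [/\ 0 < lam0 K /\ 0 < mu0 K, 0 <= epsl K /\ 0 <= epsm K,
      0 < cl K /\ 0 < cm K, 0 < lam_max K /\ 0 < mu_max K
    & [/\ 0 <= delta K, 0 < lamBmin & 0 < muBmin]].
End Constants.

Record data := MkData {
  incl : set Rd;
  lam : Rd -> R; mu : Rd -> R;
  lamD : Rd -> R; muD : Rd -> R;
  lamB : Rd -> R; muB : Rd -> R;
  noisy : 'M[R]_M }.

Definition admissible Omega (Lambda : (Rd -> R) -> (Rd -> R) -> 'M[R]_M)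
    (K : constants) (D : data) :=
  [/\ measurable (incl D : set (caratheodory_type (@lebesgue_outer R d))) /\
        incl D `<=` Omega,
      Linf_pos Omega (lam D) /\ Linf_pos Omega (mu D),
      (forall x, incl D x -> lam D x = lamD D x /\ mu D x = muD D x) /\
        (forall x, (Omega `\` incl D) x ->
           lam D x = lamB D x /\ mu D x = muB D x),
      (forall x, (Omega `\` incl D) x ->
          `|lamB D x - lam0 K| <= lam0 K * epsl K /\
          `|muB D x - mu0 K| <= mu0 K * epsm K) /\
        (forall x, incl D x ->
          cl K <= lamD D x - lam0 K /\ cm K <= muD D x - mu0 K)
    & (forall x, Omega x -> lam D x <= lam_max K /\ mu D x <= mu_max K) /\
        spectral_norm (Lambda (lam D) (mu D) - noisy D) <= delta K].

(* A method reconstructs the inclusion from the noisy measurement matrix. *)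
Definition resolution_guarantee (adm : data -> Prop) (N : nat)
    (omega : 'I_N -> set Rd) (method : 'M[R]_M -> set Rd) :=
  forall D, adm D ->
    (forall s, omega s `<=` incl D -> omega s `<=` method (noisy D)) /\
    (incl D = set0 -> method (noisy D) = set0).

End Resolution.
Arguments constants : clear implicits.
Arguments data : clear implicits.

(* Main.v *)
Require Import Defs.
From HB Require Import structures.
From mathcomp Require Import all_boot all_order all_algebra.
From mathcomp Require Import all_classical all_reals all_analysis.
From mathcomp Require Import measurable_realfun ring lra.

Set Implicit Arguments.
Unset Strict Implicit.
Unset Printing Implicit Defensive.

Import Order.TTheory GRing.Theory Num.Theory.
Import numFieldNormedType.Exports.

Local Open Scope classical_set_scope.
Local Open Scope ring_scope.


(** Write E_p(v, w) for the elastic energy with coefficients p = (lambda, mu).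
    Testing the weak formulation for p with the displacement of another
    parameter q shows that E_p(u_p, u_q) is the load applied to u_q, that is,
    an entry of the Neumann-to-Dirichlet matrix of q (NtD_energy).  Hence, as
    quadratic forms in the load coefficients,

      Lambda(q) = 2 E_p(u_p, u_q) - E_q(u_q, u_q),

    and completing the square pointwise bounds the right-hand side by
    E_w(u_p, u_p) for every weight w with p ^ 2 <= w q (hooke_young,
    energy_mx_ge_NtD).  This single comparison is used twice.

    - If a pixel lies in the inclusion, take for p the smallest background, for
      q the true parameters and w = p - kappa chi; the constants kappa are made
      so that p ^ 2 <= w q (pixel_weight).  Then E_w(u_p, u_p) is T_s, so
      T_s >= Lambda(q), and adding the noise bound marks the pixel.
    - If p <= q, take w = p: Lambda decreases as the parameters increase
      (NtD_antimonotone).  Without inclusion the true parameters are below the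
      largest background, so Lambda(true) >= Lambda(Bmax); a marked pixel would
      give T_s - Lambda(Bmax) >= - 2 delta, whose least eigenvalue contradicts
      nu < - 2 delta.

    Superposing the loads happens inside the integral, on the strains of the
    single displacements, so that no linear combination of elements of
    H^1 is ever formed.  Linearity of the energy in its coefficients needs
    Omega and the pixels to be Lebesgue measurable, and the volume is given
    only as an outer measure generated by boxes: measurability of open sets is
    proved first (measurable_open). *)

(** * Open sets are Lebesgue measurable *)

Section OpenMeasurable.
Context (R : realType) (d : nat).
Local Open Scope ereal_scope.

(** Cutting every member of a cover along H transfers the Caratheodory
    inequality from the gauge to the outer measure it generates. *)
Lemma le_mu_ext_split (T : pointedType) (tau : set (allsets T) -> \bar R)
    (H X : set (allsets T)) : (forall A, 0 <= tau A) ->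
  (forall A, tau (A `&` H) + tau (A `&` ~` H) <= tau A) ->
  mu_ext tau (X `&` H) + mu_ext tau (X `&` ~` H) <= mu_ext tau X.
Proof.
move=> tau_ge0 tau_split; apply: le_ereal_inf_tmp => _ [F [_ XF] <-].
apply: (@le_trans _ _ (\sum_(k <oo) tau (F k `&` H) +
                       \sum_(k <oo) tau (F k `&` ~` H))).
  by apply: leeD; apply: ereal_inf_lbound; eexists => //; split => //;
    rewrite -setI_bigcupl; exact: setSI.
by rewrite -nneseriesD//; apply: lee_nneseries => // k _ *; rewrite adde_ge0.
Qed.

Lemma box_gauge_le_volume (A : set 'rV[R]_d) (p q : 'rV[R]_d) :
  (forall i, p 0 i <= q 0 i)%R ->
  A `<=` [set x | forall i, (p 0 i <= x 0 i <= q 0 i)%R] ->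
  box_gauge A <= (\prod_i (q 0 i - p 0 i))%R%:E.
Proof.
move=> pq Apq; rewrite /box_gauge; case: ifPn => _.
  by rewrite lee_fin prodr_ge0// => i _; rewrite subr_ge0.
by apply: ereal_inf_lbound; exists (p, q).
Qed.

(** A hyperplane orthogonal to an axis cuts a box into two boxes whose volumes
    add up. *)
Lemma box_gauge_halfspace (i : 'I_d) (c : R) (A : set 'rV[R]_d) :
  box_gauge (A `&` [set x : 'rV[R]_d | (x 0 i <= c)%R]) +
  box_gauge (A `&` ~` [set x : 'rV[R]_d | (x 0 i <= c)%R]) <= box_gauge A.
Proof.
set H := [set x : 'rV[R]_d | (x 0 i <= c)%R]; rewrite {3}/box_gauge.
case: ifPn => [/eqP->|_].
  by rewrite !set0I box_gauge0 adde0.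
apply: le_ereal_inf_tmp => _ [[p q]] /= [pq Apq] <-.
(* Clamping c to the i-th side of the box covers the case in which the
   hyperplane misses the box. *)
pose c' := (Num.max (p 0 i) (Num.min c (q 0 i)))%R.
have pc : (p 0 i <= c')%R by rewrite le_max lexx.
have cq : (c' <= q 0 i)%R by rewrite ge_max pq ge_min lexx orbT.
pose q' : 'rV[R]_d := (\row_j (if j == i then c' else q 0 j))%R.
pose p' : 'rV[R]_d := (\row_j (if j == i then c' else p 0 j))%R.
apply: (@le_trans _ _ ((\prod_j (q' 0 j - p 0 j))%R%:E +
                       (\prod_j (q 0 j - p' 0 j))%R%:E)).
  apply: leeD; apply: box_gauge_le_volume.
  - by move=> j; rewrite mxE; case: eqP => [->|].
  - move=> x [/Apq xpq Hx] j; rewrite mxE; case: eqP => [->|_]; last exact: xpq.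
    case/andP: (xpq i) => xp xq.
    by rewrite xp /c' le_max le_min xq andbT (Hx : (x 0 i <= c)%R) orbT.
  - by move=> j; rewrite mxE; case: eqP => [->|].
  - move=> x [/Apq xpq Hx] j; rewrite mxE; case: eqP => [->|_]; last exact: xpq.
    case/andP: (xpq i) => xp xq; rewrite xq andbT /c' ge_max xp ge_min.
    by rewrite ltW// ltNge; apply/negP.
rewrite -EFinD lee_fin (bigD1 i)//= [X in (_ + X <= _)%R](bigD1 i)//=.
rewrite [leRHS](bigD1 i)//= !mxE eqxx.
rewrite (eq_bigr (fun j => q 0 j - p 0 j)%R); last first.
  by move=> j /negbTE ji; rewrite mxE ji.
rewrite [X in (_ + _ * X <= _)%R](eq_bigr
  (fun j => q 0 j - p 0 j)%R); last first.
  by move=> j /negbTE ji; rewrite mxE ji.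
by rewrite -mulrDl addrC addrA subrK.
Qed.

Let Rd : measurableType _ := caratheodory_type (@lebesgue_outer R d).

Lemma measurable_halfspace (i : 'I_d) (c : R) :
  measurable ([set x : 'rV[R]_d | (x 0 i <= c)%R] : set Rd).
Proof.
apply: (@le_caratheodory_measurable R _ (@lebesgue_om R d)) => X.
by apply: le_mu_ext_split; [exact: box_gauge_ge0|exact: box_gauge_halfspace].
Qed.

Lemma measurable_open_halfspace (i : 'I_d) (c : R) :
  measurable ([set x : 'rV[R]_d | (x 0 i < c)%R] : set Rd).
Proof.
rewrite (_ : mkset _ =
  \bigcup_n ([set x : 'rV[R]_d | (x 0 i <= c - n.+1%:R^-1)%R] : set Rd)).
  by apply: bigcup_measurable => n _; exact: measurable_halfspace.
apply/seteqP; split => [x /= xc|x [n _ /=] /le_lt_trans]; last first.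
  by apply; rewrite ltrBlDr ltrDl invr_gt0.
have [n nx] : exists n : nat, ((c - x 0 i)^-1 < n.+1%:R)%R.
  by exists (Num.truncn (c - x 0 i)^-1)%R; exact: truncnS_gt.
exists n => //=; rewrite lerBrDr -lerBrDl ltW// invf_plt// posrE//.
by rewrite subr_gt0.
Qed.

(** There are countably many cubes with rational centre and radius 1/(n+1), and
    each of them is a finite intersection of half-spaces. *)
Lemma measurable_open (U : set 'rV[R]_d) : open U -> measurable (U : set Rd).
Proof.
move=> oU.
pose B (q : 'rV[rat]_d * nat) : set 'rV[R]_d :=
  [set x | forall i, (`|ratr (q.1 0 i) - x 0 i| < q.2.+1%:R^-1)%R].
rewrite (_ : U = \bigcup_(q in [set q | B q `<=` U]) (B q : set Rd)).
  rewrite bigcup_mkcond; apply: countable_bigcupT_measurable => [|q].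
    exact: countableP.
  case: ifPn => _ //.
  rewrite (_ : B q = \bigcap_(i in [set: 'I_d])
    [set x | (`|ratr (q.1 0 i) - x 0 i| < q.2.+1%:R^-1)%R]); last first.
    by apply/seteqP; split => [x Bx i _|x Bx i]; exact: Bx.
  apply: fin_bigcap_measurable => // i _.
  rewrite (_ : mkset _ = ~` [set x | (x 0 i <= ratr (q.1 0 i) - q.2.+1%:R^-1)%R]
     `&` [set x | (x 0 i < ratr (q.1 0 i) + q.2.+1%:R^-1)%R]).
    by apply: measurableI; [apply: measurableC; exact: measurable_halfspace|
                            exact: measurable_open_halfspace].
  apply/seteqP; split => x /=.
    rewrite distrC ltr_distl => /andP[? ?]; split => //.
    by apply/negP; rewrite -ltNge.
  by move=> [/negP]; rewrite -ltNge distrC ltr_distl => -> ->.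
apply/seteqP; split => [x Ux|x [q /= qU qx]]; last exact: qU.
have /nbhs_ballP[e /= e0 xeU] : nbhs x U by exact: open_nbhs_nbhs.
have [n ne] : exists n : nat, (n.+1%:R^-1 < e / 2)%R.
  exists (Num.truncn (e / 2)^-1)%R; rewrite invf_plt ?posrE ?divr_gt0//.
  by rewrite truncnS_gt.
have qi i : exists q : rat, (`|ratr q - x 0 i| < n.+1%:R^-1 :> R)%R.
  have [|q qx] := @rat_in_itvoo R (x 0 i - n.+1%:R^-1)%R (x 0 i + n.+1%:R^-1)%R.
    by rewrite ltrBlDr -addrA ltrDl addr_gt0 // invr_gt0.
  by exists q; rewrite ltr_distl; rewrite in_itv/= in qx.
have [f fx] := choice qi.
exists (\row_i f i, n)%R => /= [y By|i /=]; last by rewrite mxE.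
apply: xeU; split => // j i; rewrite ord1 /ball /= .
have := By i; have := fx i; rewrite /= mxE => h1 h2.
rewrite (_ : _ - _ = (x 0 i - ratr (f i)) + (ratr (f i) - y 0 i))%R; last first.
  by rewrite addrA subrK.
rewrite (le_lt_trans (ler_normD _ _))// [ltRHS]splitr ltrD//.
  by rewrite distrC (lt_trans h1).
exact: lt_trans h2 _.
Qed.

End OpenMeasurable.

(** * Integrals of possibly non-measurable functions *)

Section NullSets.
Context (dd : measure_display) (T : measurableType dd) (R : realType).
Variable m : {measure set T -> \bar R}.
Local Open Scope ereal_scope.
Import HBNNSimple.

(** The simple function h is replaced by 0 on the null set, where nothing is
    known of g but its sign. *)
Lemma nnsfun_off_null (f g : T -> \bar R) (N : set T) (h : {nnsfun T >-> R}) :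
  measurable N -> m N = 0 -> (forall x, ~ N x -> f x = g x) ->
  (forall x, 0 <= g x) -> (forall x, (h x)%:E <= f x) ->
  exists h' : {nnsfun T >-> R}, (forall x, (h' x)%:E <= g x) /\
    sintegral m h' = sintegral m h.
Proof.
move=> mN N0 fg g0 hf.
have mNC : measurable (~` N) by exact: measurableC.
exists (proj_nnsfun h mNC); split => [x|].
  rewrite /= mindicE; have [Nx|Nx] := boolP (x \in ~` N).
    by rewrite mulr1 -fg//; rewrite inE in Nx.
  by rewrite mulr0.
rewrite -!integralT_nnsfun; apply: ge0_ae_eq_integral => //.
- by apply/measurable_EFinP.
- by apply/measurable_EFinP.
- by move=> x _; rewrite lee_fin.
- by move=> x _; rewrite lee_fin.
exists N; split => // x; apply: contra_notP => Nx _ /=.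
by rewrite mindicE mem_set// mulr1.
Qed.

Lemma integral_eq_off_null (f g : T -> \bar R) (N : set T) :
  measurable N -> m N = 0 -> (forall x, ~ N x -> f x = g x) ->
  \int[m]_x f x = \int[m]_x g x.
Proof.
move=> mN N0 fg.
have sub (F G : T -> \bar R) : (forall x, ~ N x -> F x = G x) ->
    (forall x, 0 <= G x) ->
    [set sintegral m h | h in [set h : {nnsfun T >-> R} |
      forall x, (h x)%:E <= F x]] `<=`
    [set sintegral m h | h in [set h : {nnsfun T >-> R} |
      forall x, (h x)%:E <= G x]].
  move=> FG G0 _ [h /= hF <-].
  by have [h' []] := nnsfun_off_null mN N0 FG G0 hF; exists h'.
rewrite /integral !patch_setT.
congr (ereal_sup _ - ereal_sup _); apply/seteqP; split; apply: sub => x;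
  do ?[exact: funepos_ge0 | exact: funeneg_ge0];
  by move=> /fg fgx; rewrite ?funeposE ?funenegE fgx.
Qed.

(** Modifying simple functions on a null set settles the case of arbitrary B and
    f at once; it is applied to the Neumann boundary, given only as a relatively
    open set, with the Hausdorff measure. *)
Lemma Rintegral_sub_support (A B : set T) (f : T -> R) : A `<=` B ->
  {ae m, forall x, B x -> ~ A x -> f x = 0%R} ->
  (\int[m]_(x in A) f x = \int[m]_(x in B) f x)%R.
Proof.
move=> AB [N [mN N0 fN]]; rewrite Rintegral_mkcond [RHS]Rintegral_mkcond.
congr fine; apply: (integral_eq_off_null mN N0) => x Nx; congr (_%:E).
rewrite /restrict/=; have [xA|xA] := boolP (x \in A).
  by rewrite mem_set//; apply: AB; rewrite inE in xA.
case: ifPn => // xB; apply/esym; move: xB xA; rewrite inE notin_setE => Bx Ax.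
by apply: contrapT => f0; apply: Nx; apply: fN => /= /(_ Bx Ax).
Qed.

End NullSets.

(** * Quadratic forms, spectral norm and least eigenvalue *)

Section MatrixForms.
Context {R : realType} {n : nat}.
Implicit Types (x y : 'rV[R]_n) (A B : 'M[R]_n).

Lemma dot_ge0 x : 0 <= dot x x.
Proof. by apply: sumr_ge0 => i _; exact: sqr_ge0. Qed.

Lemma enorm_sqr x : enorm x ^+ 2 = dot x x.
Proof. by rewrite sqr_sqrtr// dot_ge0. Qed.

Lemma dot_eq0 x : dot x x = 0 -> x = 0.
Proof.
move=> /eqP; rewrite psumr_eq0 => [/allP x0|i _]; last exact: sqr_ge0.
apply/rowP => i; rewrite mxE; apply/eqP.
by have := x0 i (mem_index_enum i); rewrite mulf_eq0 orbb.
Qed.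

Lemma dotC x y : dot x y = dot y x.
Proof. by apply: eq_bigr => i _; rewrite mulrC. Qed.

Lemma dotDl x y z : dot (x + y) z = dot x z + dot y z.
Proof. by rewrite -big_split; apply: eq_bigr => i _; rewrite mxE mulrDl. Qed.

Lemma dotZl (a : R) x y : dot (a *: x) y = a * dot x y.
Proof. by rewrite mulr_sumr; apply: eq_bigr => i _; rewrite mxE mulrA. Qed.

(** Cauchy-Schwarz, from the square of |y| x - |x| y. *)
Lemma dot_le_enormM x y : dot x y <= enorm x * enorm y.
Proof.
have [x0|x0] := eqVneq x 0.
  by rewrite x0 /dot big1 ?mulr_ge0 ?sqrtr_ge0// => i _; rewrite mxE mul0r.
have [y0|y0] := eqVneq y 0.
  by rewrite y0 /dot big1 ?mulr_ge0 ?sqrtr_ge0// => i _; rewrite mxE mulr0.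
have nz (z : 'rV[R]_n) : z != 0 -> 0 < enorm z.
  move=> z0; rewrite sqrtr_gt0 lt_neqAle dot_ge0 andbT eq_sym.
  by apply: contraNneq z0 => /dot_eq0 ->.
have st : 0 < enorm x * enorm y by rewrite mulr_gt0 ?nz.
have := dot_ge0 (enorm y *: x + (- enorm x) *: y).
rewrite dotDl !dotZl ![dot _ (_ + _)]dotC !dotDl !dotZl [dot y x]dotC.
rewrite -!enorm_sqr => h.
suff : 0 <= enorm x * enorm y * (enorm x * enorm y - dot x y).
  by rewrite pmulr_rge0// subr_ge0.
nra.
Qed.

(** The supremum defining the spectral norm bounds its members only because the
    set is bounded, here by the row sums of A. *)
Lemma enorm_mulmx_le A x : enorm (x *m A^T) <= spectral_norm A * enorm x.
Proof.
have bA : has_ubound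
    [set enorm (z *m A^T) | z in [set z : 'rV[R]_n | enorm z <= 1]].
  exists (Num.sqrt (\sum_j (\sum_i `|A j i|) ^+ 2)) => _ [z /= z1 <-].
  apply: ler_wsqrtr; apply: ler_sum => j _.
  rewrite -expr2 -real_normK ?num_real// ler_sqr ?nnegrE ?sumr_ge0//.
  rewrite mxE (le_trans (ler_norm_sum _ _ _))//; apply: ler_sum => i _.
  rewrite mxE normrM ler_piMl// -(@ler_sqr R)// ?nnegrE//.
  rewrite expr1n real_normK ?num_real//.
  apply: (@le_trans _ _ (dot z z)).
    rewrite /dot (bigD1 i)//= expr2 lerDl.
    by apply: sumr_ge0 => k _; exact: sqr_ge0.
  by rewrite -enorm_sqr expr_le1 ?sqrtr_ge0.
have [->|x0] := eqVneq x 0.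
  by rewrite mul0mx /enorm /dot !big1 ?sqrtr0 ?mulr0// => i _;
    rewrite mxE mul0r.
have x_gt0 : 0 < enorm x.
  rewrite sqrtr_gt0 lt_neqAle dot_ge0 andbT eq_sym.
  by apply: contraNneq x0 => /dot_eq0 ->.
have nZ (a : R) (z : 'rV[R]_n) : 0 <= a -> enorm (a *: z) = a * enorm z.
  move=> a0; rewrite /enorm dotZl dotC dotZl mulrA -expr2 sqrtrM ?sqr_ge0//.
  by rewrite sqrtr_sqr ger0_norm.
rewrite -ler_pdivrMr// mulrC -nZ ?invr_ge0 ?sqrtr_ge0// scalemxAl.
apply: ub_le_sup => //; exists ((enorm x)^-1 *: x) => //=.
by rewrite nZ ?invr_ge0 ?sqrtr_ge0// mulVf// gt_eqF.
Qed.

Lemma mxform_dot A (x : 'cV[R]_n) : (x^T *m A *m x) 0 0 = dot x^T (x^T *m A^T).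
Proof.
by rewrite -mulmxA -trmx_mul mxE; apply: eq_bigr => i _; rewrite !mxE.
Qed.

Lemma mxform_tr A (x : 'cV[R]_n) : (x^T *m A^T *m x) 0 0 = (x^T *m A *m x) 0 0.
Proof.
transitivity ((x^T *m A *m x)^T 0 0); last by rewrite mxE.
by rewrite !trmx_mul trmxK mulmxA.
Qed.

Lemma mxformD A B (x : 'cV[R]_n) :
  (x^T *m (A + B) *m x) 0 0 = (x^T *m A *m x) 0 0 + (x^T *m B *m x) 0 0.
Proof. by rewrite mulmxDr mulmxDl mxE. Qed.

Lemma mxformN A (x : 'cV[R]_n) :
  (x^T *m (- A) *m x) 0 0 = - (x^T *m A *m x) 0 0.
Proof. by rewrite mulmxN mulNmx mxE. Qed.

Lemma mxformB A B (x : 'cV[R]_n) :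
  (x^T *m (A - B) *m x) 0 0 = (x^T *m A *m x) 0 0 - (x^T *m B *m x) 0 0.
Proof. by rewrite mxformD mxformN. Qed.

Lemma mxform_le_spectral A (x : 'cV[R]_n) (c : R) : spectral_norm A <= c ->
  `|(x^T *m A *m x) 0 0| <= c * dot x^T x^T.
Proof.
move=> Ac; have key (s : R) : `|s| = 1 ->
    s * (x^T *m A *m x) 0 0 <= c * dot x^T x^T.
  move=> s1; rewrite mxform_dot -dotZl (le_trans (dot_le_enormM _ _))//.
  have -> : enorm (s *: x^T) = enorm x^T.
    rewrite /enorm dotZl dotC dotZl mulrA -expr2 -real_normK ?num_real//.
    by rewrite s1 expr1n mul1r.
  rewrite -enorm_sqr expr2 mulrA [leRHS]mulrC ler_wpM2l ?sqrtr_ge0//.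
  by rewrite (le_trans (enorm_mulmx_le _ _))// ler_wpM2r ?sqrtr_ge0.
rewrite ler_norml; apply/andP; split; last by rewrite -[leLHS]mul1r key ?normr1.
by rewrite lerNl -mulN1r key// normrN1.
Qed.

Lemma mxform_scalar (a : R) (x : 'cV[R]_n) :
  (x^T *m a%:M *m x) 0 0 = a * dot x^T x^T.
Proof.
rewrite mul_mx_scalar -scalemxAl !mxE; congr (_ * _).
by apply: eq_bigr => i _; rewrite !mxE.
Qed.

(** The Rayleigh quotient of an eigenvector is its eigenvalue.  The sign of a
    covers a matrix without real eigenvalue, for which the infimum is 0. *)
Lemma mxge_lb_min_eig A (a : R) : a <= 0 -> mxge A a%:M -> a <= min_eig A.
Proof.
move=> a0 Aa; rewrite /min_eig.
have eig_ge : lbound [set b : R | eigenvalue A b] a.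
  move=> b /= /eigenvalueP[v vA v0].
  have := Aa v^T; rewrite mxform_scalar trmxK vA -scalemxAl mxE.
  rewrite (_ : (v *m v^T) 0 0 = dot v v); last first.
    by rewrite mxE; apply: eq_bigr => i _; rewrite mxE.
  rewrite ler_pM2r// lt_neqAle dot_ge0 andbT eq_sym.
  by apply: contraNneq v0 => /dot_eq0 ->.
have [->|/set0P ne] := eqVneq [set b : R | eigenvalue A b] set0.
  by rewrite inf0.
exact: lb_le_inf.
Qed.

End MatrixForms.

(** * The elastic energy as a quadratic form in the loads *)

Section Energy.
Context {R : realType} {d : nat}.
Variable Omega : set 'rV[R]_d.
Hypothesis mO :
  measurable (Omega : set (caratheodory_type (@lebesgue_outer R d))).
Implicit Types (f g w lam mu : 'rV[R]_d -> R) (A B : 'M[R]_d).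
Local Notation leb := (@Leb R d).
Local Notation L2O := (L2 (@Leb R d) Omega).
Local Notation Rd := (caratheodory_type (@lebesgue_outer R d)).

(** Bounded everywhere on Omega, not only almost everywhere: the admissible
    coefficients are, and integrability then needs no exceptional set. *)
Definition bounded_coef w :=
  measurable_fun (Omega : set Rd) (w : Rd -> R) /\
  exists C, forall x, Omega x -> `|w x| <= C.

Lemma L2Z (a : R) f : L2O f -> L2O (fun x => a * f x).
Proof.
move=> [mf f2]; split; first exact: measurable_funM.
apply: eq_integrable (integrableZl mO (a ^+ 2) f2) => // x _ /=.
by rewrite -EFinM exprMn.
Qed.

Lemma L2D f g : L2O f -> L2O g -> L2O (fun x => f x + g x).
Proof.
move=> [mf f2] [mg g2]; have mfg := measurable_funD mf mg; split => //.
apply: (le_integrable mO) (integrableZl mO 2 (integrableD mO f2 g2)).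
  by apply/measurable_EFinP; exact: measurable_funX.
move=> x _ /=; rewrite lee_fin (ger0_norm (sqr_ge0 _)) ger0_norm.
  by have := sqr_ge0 (f x - g x); nra.
by rewrite mulr_ge0// addr_ge0// sqr_ge0.
Qed.

Lemma L2_sum (I : Type) (s : seq I) (F : I -> 'rV[R]_d -> R) :
  (forall i, L2O (F i)) -> L2O (fun x => \sum_(i <- s) F i x).
Proof.
move=> LF; elim: s => [|i s ih].
  under eq_fun do rewrite big_nil; split; first exact: measurable_cst.
  by under eq_fun do rewrite expr0n; exact: integrable0.
by under eq_fun do rewrite big_cons; exact: L2D.
Qed.

Lemma integrable_coefM w f g : bounded_coef w -> L2O f -> L2O g ->
  leb.-integrable Omega (fun x => (w x * (f x * g x))%:E).
Proof.
move=> [mw [C wC]] [mf f2] [mg g2].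
apply: (le_integrable mO) (integrableZl mO C (integrableD mO f2 g2)).
  by apply/measurable_EFinP;
     exact: (measurable_funM mw (measurable_funM mf mg)).
move=> x Ox /=; rewrite lee_fin !normrM.
have C0 : 0 <= C := le_trans (normr_ge0 _) (wC x Ox).
rewrite (ger0_norm C0) [X in _ <= _ * X]ger0_norm ?addr_ge0 ?sqr_ge0//.
apply: ler_pM; rewrite ?mulr_ge0 ?wC//.
rewrite -[f x ^+ 2]real_normK ?num_real// -[g x ^+ 2]real_normK ?num_real//.
have := sqr_ge0 (`|f x| - `|g x|).
have := sqr_ge0 `|f x|; have := sqr_ge0 `|g x|.
nra.
Qed.

(** The inner product of the stress of the strain A with the strain B, for the
    Lame parameters l and m. *)
Definition hooke (l m : R) A B : R := 2 * m * frob A B + l * (\tr A * \tr B).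

(** The divergence is the trace of the symmetric gradient, so the energy density
    depends on the displacements only through their strains. *)
Lemma energyE lam mu (v w : H1 Omega) : energy lam mu v w =
  \int[leb]_(x in Omega) hooke (lam x) (mu x) (symgrad v x) (symgrad w x).
Proof.
have trE (z : H1 Omega) x : \tr (symgrad z x) = divergence z x.
  rewrite /symgrad mxtraceZ mxtraceD mxtrace_tr /divergence.
  by rewrite -mulr2n -[X in _ * X]mulr_natl mulKf// pnatr_eq0.
by apply: eq_Rintegral => x _; rewrite /hooke !trE.
Qed.

Lemma frobDl A A' B : frob (A + A') B = frob A B + frob A' B.
Proof.
rewrite -big_split; apply: eq_bigr => i _; rewrite -big_split.
by apply: eq_bigr => j _; rewrite mxE mulrDl.
Qed.

Lemma frobZl (a : R) A B : frob (a *: A) B = a * frob A B.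
Proof.
rewrite mulr_sumr; apply: eq_bigr => i _; rewrite mulr_sumr.
by apply: eq_bigr => j _; rewrite mxE mulrA.
Qed.

Lemma frobC A B : frob A B = frob B A.
Proof. by apply: eq_bigr => i _; apply: eq_bigr => j _; rewrite mulrC. Qed.

Lemma hookeC l m A B : hooke l m A B = hooke l m B A.
Proof. by rewrite /hooke frobC [\tr A * _]mulrC. Qed.

Lemma hooke_suml l m (I : Type) (s : seq I) (F : I -> 'M[R]_d) B :
  hooke l m (\sum_(i <- s) F i) B = \sum_(i <- s) hooke l m (F i) B.
Proof.
elim: s => [|i s ih]; last first.
  by rewrite !big_cons -ih /hooke frobDl mxtraceD; ring.
rewrite !big_nil /hooke mxtrace0 mul0r mulr0 addr0.
by rewrite -(scale0r B) frobZl mul0r mulr0.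
Qed.

Lemma hookeZl l m (a : R) A B : hooke l m (a *: A) B = a * hooke l m A B.
Proof. by rewrite /hooke frobZl mxtraceZ; ring. Qed.

Lemma symgrad_L2 (v : H1 Omega) i j : L2O (fun x => symgrad v x i j).
Proof.
under eq_fun do rewrite !mxE.
by apply: L2Z; apply: L2D; exact: jacL2.
Qed.

Lemma trace_symgrad_L2 (v : H1 Omega) : L2O (fun x => \tr (symgrad v x)).
Proof. by apply: L2_sum => i; exact: symgrad_L2. Qed.

Lemma integrable_hooke lam mu (v w : H1 Omega) :
  bounded_coef lam -> bounded_coef mu ->
  leb.-integrable Omega
    (fun x => (hooke (lam x) (mu x) (symgrad v x) (symgrad w x))%:E).
Proof.
move=> blam [mmu [C muC]]; under eq_fun do rewrite /hooke EFinD.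
have b2mu : bounded_coef (fun x => 2 * mu x).
  split; first exact: measurable_funM.
  by exists (2 * C) => x Ox; rewrite normrM ger0_norm// ler_pM2l// muC.
have itr : leb.-integrable Omega (fun x =>
    (lam x * (\tr (symgrad v x) * \tr (symgrad w x)))%:E).
  exact: (integrable_coefM blam (trace_symgrad_L2 v) (trace_symgrad_L2 w)).
have ifrob : leb.-integrable Omega (fun x =>
    (2 * mu x * frob (symgrad v x) (symgrad w x))%:E).
  rewrite (_ : (fun x => _) = (fun x => \sum_i \sum_j
    (2 * mu x * (symgrad v x i j * symgrad w x i j))%:E)%E).
    apply: (integrable_sum mO) => i _; apply: (integrable_sum mO) => j _.
    exact: (integrable_coefM b2mu (symgrad_L2 v i j) (symgrad_L2 w i j)).
  apply/funext => x; rewrite mulr_sumr -sumEFin; apply: eq_bigr => i _.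
  by rewrite mulr_sumr -sumEFin.
exact: (integrableD mO ifrob itr).
Qed.

(** Completing the square, entry by entry for the shear part and once for the
    trace part:
    p2 (p a^2 - 2 p1 a b + p2 b^2) = (p p2 - p1^2) a^2 + (p1 a - p2 b)^2. *)
Lemma hooke_young l1 m1 l2 m2 l m A B :
  0 < l2 -> 0 < m2 -> l1 ^+ 2 <= l * l2 -> m1 ^+ 2 <= m * m2 ->
  2 * hooke l1 m1 A B - hooke l2 m2 B B <= hooke l m A A.
Proof.
move=> l20 m20 hl hm.
have young p1 p2 p a b : 0 < p2 -> p1 ^+ 2 <= p * p2 ->
    2 * p1 * (a * b) - p2 * (b * b) <= p * (a * a) :> R.
  move=> p20 hp; rewrite -(ler_pM2l p20) -subr_ge0.
  have -> : p2 * (p * (a * a)) - p2 * (2 * p1 * (a * b) - p2 * (b * b)) =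
    (p * p2 - p1 ^+ 2) * a ^+ 2 + (p1 * a - p2 * b) ^+ 2 by ring.
  by rewrite addr_ge0 ?sqr_ge0// mulr_ge0 ?sqr_ge0// subr_ge0.
have hfrob : 2 * m1 * frob A B - m2 * frob B B <= m * frob A A.
  rewrite !mulr_sumr -sumrB; apply: ler_sum => i _.
  rewrite !mulr_sumr -sumrB; apply: ler_sum => j _; exact: young.
have := young _ _ _ (\tr A) (\tr B) l20 hl.
rewrite /hooke; lra.
Qed.

Section Superposition.
Context {M : nat}.
Implicit Types (u v : 'I_M -> H1 Omega) (c : 'cV[R]_M).

(** The symmetric gradient of the displacement under the combined load
    \sum_k c_k g_k. *)
Definition strain c u x : 'M[R]_d := \sum_k c k 0 *: symgrad (u k) x.

Definition energy_mx lam mu u v : 'M[R]_M :=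
  \matrix_(k, l) energy lam mu (u k) (v l).

Lemma mxform_sum (A : 'M[R]_M) c :
  (c^T *m A *m c) 0 0 = \sum_k \sum_l c k 0 * c l 0 * A k l.
Proof.
rewrite mxE exchange_big/=; apply: eq_bigr => l _.
rewrite mxE mulr_suml; apply: eq_bigr => k _; rewrite !mxE; ring.
Qed.

Lemma hooke_strainE lam mu u v c x :
  hooke (lam x) (mu x) (strain c u x) (strain c v x) =
  \sum_k \sum_l c k 0 * c l 0 *
    hooke (lam x) (mu x) (symgrad (u k) x) (symgrad (v l) x).
Proof.
rewrite hooke_suml; apply: eq_bigr => k _.
rewrite hookeZl hookeC hooke_suml mulr_sumr; apply: eq_bigr => l _.
by rewrite hookeZl hookeC mulrA.
Qed.

Lemma integrable_hooke_term lam mu u v c k l :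
  bounded_coef lam -> bounded_coef mu ->
  leb.-integrable Omega (fun x =>
    (c k 0 * c l 0 *
      hooke (lam x) (mu x) (symgrad (u k) x) (symgrad (v l) x))%:E).
Proof.
move=> blam bmu.
exact: (integrableZl mO (c k 0 * c l 0)
  (integrable_hooke (u k) (v l) blam bmu)).
Qed.

Lemma integrable_strain lam mu u v c : bounded_coef lam -> bounded_coef mu ->
  leb.-integrable Omega
    (fun x => (hooke (lam x) (mu x) (strain c u x) (strain c v x))%:E).
Proof.
move=> blam bmu; rewrite (_ : (fun x => _) = (fun x => \sum_k \sum_l
  (c k 0 * c l 0 *
      hooke (lam x) (mu x) (symgrad (u k) x) (symgrad (v l) x))%:E)%E).
  apply: (integrable_sum mO) => k _; apply: (integrable_sum mO) => l _.
  exact: integrable_hooke_term.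
apply/funext => x; rewrite hooke_strainE -sumEFin.
by apply: eq_bigr => k _; rewrite -sumEFin.
Qed.

Lemma Rintegral_sum (I : Type) (s : seq I) (F : I -> 'rV[R]_d -> R) :
  (forall i, leb.-integrable Omega (fun x => (F i x)%:E)) ->
  \int[leb]_(x in Omega) (\sum_(i <- s) F i x) =
  \sum_(i <- s) \int[leb]_(x in Omega) F i x.
Proof.
move=> iF; elim: s => [|i s ih].
  rewrite big_nil; under eq_Rintegral do rewrite big_nil.
  by rewrite Rintegral_cst// mul0r.
have is_ : leb.-integrable Omega (fun x => (\sum_(j <- s) F j x)%:E).
  by rewrite (_ : (fun x => _) = (fun x => \sum_(j <- s) (F j x)%:E)%E);
    [exact: (integrable_sum mO)|apply/funext => x; rewrite sumEFin].
rewrite big_cons -ih -RintegralD//; last exact: iF.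
by apply: eq_Rintegral => x _; rewrite big_cons.
Qed.

Lemma energy_mx_form lam mu u v c : bounded_coef lam -> bounded_coef mu ->
  (c^T *m energy_mx lam mu u v *m c) 0 0 =
  \int[leb]_(x in Omega) hooke (lam x) (mu x) (strain c u x) (strain c v x).
Proof.
move=> blam bmu; rewrite mxform_sum.
under eq_Rintegral do rewrite hooke_strainE.
rewrite Rintegral_sum => [|k].
  apply: eq_bigr => k _; rewrite Rintegral_sum => [|l].
    apply: eq_bigr => l _; rewrite mxE energyE RintegralZl//.
    exact: integrable_hooke.
  exact: integrable_hooke_term.
rewrite (_ : (fun x => _) = (fun x => \sum_l
  (c k 0 * c l 0 *
      hooke (lam x) (mu x) (symgrad (u k) x) (symgrad (v l) x))%:E)%E).
  by apply: (integrable_sum mO) => l _; exact: integrable_hooke_term.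
by apply/funext => x; rewrite sumEFin.
Qed.

Lemma energy_mx_young l1 m1 l2 m2 l m u1 u2 c :
  bounded_coef l1 -> bounded_coef m1 -> bounded_coef l2 -> bounded_coef m2 ->
  bounded_coef l -> bounded_coef m ->
  (forall x, Omega x -> [/\ 0 < l2 x, 0 < m2 x,
    l1 x ^+ 2 <= l x * l2 x & m1 x ^+ 2 <= m x * m2 x]) ->
  2 * (c^T *m energy_mx l1 m1 u1 u2 *m c) 0 0 -
    (c^T *m energy_mx l2 m2 u2 u2 *m c) 0 0
  <= (c^T *m energy_mx l m u1 u1 *m c) 0 0.
Proof.
move=> bl1 bm1 bl2 bm2 bl bm h; rewrite !energy_mx_form//.
have i1 := integrable_strain u1 u2 c bl1 bm1.
have i2 := integrable_strain u2 u2 c bl2 bm2.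
rewrite -RintegralZl// -RintegralB//; last exact: (integrableZl mO 2 i1).
apply: le_Rintegral => //.
  exact: (integrableB mO (integrableZl mO 2 i1) i2).
  exact: integrable_strain.
by move=> x /h[? ? ? ?]; exact: hooke_young.
Qed.

Lemma energy_mxB l1 m1 l2 m2 u v :
  bounded_coef l1 -> bounded_coef m1 -> bounded_coef l2 -> bounded_coef m2 ->
  energy_mx (fun x => l1 x - l2 x) (fun x => m1 x - m2 x) u v =
  energy_mx l1 m1 u v - energy_mx l2 m2 u v.
Proof.
move=> bl1 bm1 bl2 bm2; apply/matrixP => k l.
rewrite !mxE !energyE -RintegralB//.
- by apply: eq_Rintegral => x _; rewrite /hooke; ring.
- exact: integrable_hooke.
- exact: integrable_hooke.
Qed.

End Superposition.
End Energy.

(** * Comparison of Neumann-to-Dirichlet matrices *)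

Section Comparison.
Context {R : realType} {d M : nat}.
Variables (Omega GammaD GammaN : set 'rV[R]_d).
Hypothesis mO :
  measurable (Omega : set (caratheodory_type (@lebesgue_outer R d))).
Variables (P : 'I_M -> set 'rV[R]_d) (g : 'I_M -> 'rV[R]_d -> 'rV[R]_d).
Hypothesis loads : boundary_loads GammaN P g.
Implicit Types (u v : 'I_M -> H1 Omega) (l m lam mu : 'rV[R]_d -> R).

(** The loads vanish outside their patches, so the integral over the patch P l
    is the load functional of g l, which the weak formulation computes. *)
Lemma NtD_load u (k l : 'I_M) : NtD P g u k l =
  \int[@surf R d]_(x in GammaN) dot (g l x) (trace (u k) x).
Proof.
case: loads => [PN _ _ g0]; rewrite mxE.
apply: Rintegral_sub_support; first exact: (PN l).1.
apply: negligibleS (g0 l); apply: subsetC => x /= h Nx Px.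
rewrite (h Nx Px) /dot big1// => i _.
by rewrite mxE mul0r.
Qed.

(** The displacements v are test functions here and may belong to any other
    parameters than the solutions u. *)
Lemma NtD_energy lam mu u v :
  (forall k, weak_solution GammaD GammaN lam mu (g k) (u k)) ->
  (forall k, vanishes_on GammaD (v k)) ->
  NtD P g v = (energy_mx lam mu u v)^T.
Proof.
by move=> wu v0; apply/matrixP => k l; rewrite NtD_load !mxE (wu l).2.
Qed.

(** The comparison behind both halves of the guarantee: both energies on the
    left of energy_mx_young are NtD P g u2, up to transposition. *)
Lemma energy_mx_ge_NtD l1 m1 l2 m2 l m u1 u2 :
  bounded_coef Omega l1 -> bounded_coef Omega m1 ->
  bounded_coef Omega l2 -> bounded_coef Omega m2 ->
  bounded_coef Omega l -> bounded_coef Omega m ->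
  (forall k, weak_solution GammaD GammaN l1 m1 (g k) (u1 k)) ->
  (forall k, weak_solution GammaD GammaN l2 m2 (g k) (u2 k)) ->
  (forall x, Omega x -> [/\ 0 < l2 x, 0 < m2 x,
    l1 x ^+ 2 <= l x * l2 x & m1 x ^+ 2 <= m x * m2 x]) ->
  mxge (energy_mx l m u1 u1) (NtD P g u2).
Proof.
move=> bl1 bm1 bl2 bm2 bl bm w1 w2 h c.
have v2 k : vanishes_on GammaD (u2 k) := (w2 k).1.
have := energy_mx_young mO u1 u2 c bl1 bm1 bl2 bm2 bl bm h.
rewrite -(mxform_tr (energy_mx l1 m1 u1 u2)) -(NtD_energy w1 v2).
rewrite -(mxform_tr (energy_mx l2 m2 u2 u2)) -(NtD_energy w2 v2).
by rewrite mulr_natl mulr2n addrK.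
Qed.

(** The weight l1, m1 itself is admissible in the comparison as soon as
    l1 <= l2 and m1 <= m2. *)
Lemma NtD_antimonotone l1 m1 l2 m2 u1 u2 :
  bounded_coef Omega l1 -> bounded_coef Omega m1 ->
  bounded_coef Omega l2 -> bounded_coef Omega m2 ->
  (forall k, weak_solution GammaD GammaN l1 m1 (g k) (u1 k)) ->
  (forall k, weak_solution GammaD GammaN l2 m2 (g k) (u2 k)) ->
  (forall x, Omega x -> 0 < l1 x <= l2 x /\ 0 < m1 x <= m2 x) ->
  mxge (NtD P g u1) (NtD P g u2).
Proof.
move=> bl1 bm1 bl2 bm2 w1 w2 h c.
rewrite [in leRHS](NtD_energy w1 (fun k => (w1 k).1)) mxform_tr.
apply: (energy_mx_ge_NtD bl1 bm1 bl2 bm2 bl1 bm1 w1 w2) => x /h.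
move=> [/andP[l0 l12] /andP[m0 m12]].
by rewrite (lt_le_trans l0)// (lt_le_trans m0)// !expr2 !ler_pM2l.
Qed.

End Comparison.

(** * Admissible coefficients *)

Section Coefficients.
Context {R : realType} {d : nat}.
Variable Omega : set 'rV[R]_d.
Local Notation Rd := (caratheodory_type (@lebesgue_outer R d)).

Lemma Linf_pos_cst (c : R) : 0 < c -> Linf_pos Omega (cst c).
Proof.
move=> c0; split.
  split; first exact: measurable_cst.
  by exists c; apply: aeW => x _; rewrite ger0_norm// ltW.
apply: (@lt_le_trans _ _ c%:E); first by rewrite lte_fin.
by apply: ereal_sup_ubound; apply: aeW.
Qed.

Lemma bounded_coef_cst (c : R) : bounded_coef Omega (cst c).
Proof. by split; [exact: measurable_cst|exists `|c|]. Qed.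

Lemma bounded_coef_indic (c : R) (A : set 'rV[R]_d) : open A ->
  bounded_coef Omega (fun x => c * \1_A x).
Proof.
move=> /measurable_open mA; split.
  by apply: measurable_funM; [exact: measurable_cst|exact: measurable_indic].
exists `|c| => x _; rewrite normrM ler_piMr// indicE.
by case: (x \in A); rewrite ?normr1 ?normr0.
Qed.

Lemma bounded_coefB (v w : 'rV[R]_d -> R) : bounded_coef Omega v ->
  bounded_coef Omega w -> bounded_coef Omega (fun x => v x - w x).
Proof.
move=> [mv [C vC]] [mw [D wD]]; split; first exact: measurable_funB.
by exists (C + D) => x Ox; rewrite (le_trans (ler_normB _ _))// lerD ?vC ?wD.
Qed.

(** This inequality is where the constants kappa = c p1 / pmax come from:
    p1^2 <= (p1 - kappa) p2 amounts to kappa <= p1 (p2 - p1) / p2, and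
    p2 - p1 >= c and p2 <= pmax on the inclusion. *)
Lemma pixel_weight (p1 p2 pmax c : R) (A : set 'rV[R]_d) x :
  0 < p1 -> p1 <= p2 -> p2 <= pmax -> 0 <= c ->
  (A x -> p1 + c <= p2) ->
  p1 ^+ 2 <= (p1 - c * (p1 / pmax) * \1_A x) * p2.
Proof.
move=> p10 p12 p2max c0 hA.
have p2_gt0 : 0 < p2 := lt_le_trans p10 p12.
have pmax_gt0 : 0 < pmax := lt_le_trans p2_gt0 p2max.
rewrite indicE; have [xA|_] := boolP (x \in A); last first.
  by rewrite mulr0 subr0 expr2 ler_pM2l.
rewrite inE in xA; have := hA xA => pc.
rewrite mulr1 mulrBl -subr_ge0.
have -> : p1 * p2 - c * (p1 / pmax) * p2 - p1 ^+ 2 =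
    p1 * (p2 - (p1 + c)) + p1 * c * (1 - p2 / pmax).
  ring.
rewrite addr_ge0// !mulr_ge0 ?subr_ge0// ?(ltW p10)//.
by rewrite ler_pdivrMr// mul1r.
Qed.

End Coefficients.

(** * The resolution guarantee *)

Lemma le_sup_finite (R : realType) (I : finType) (F : I -> R) (i : I) :
  F i <= sup [set F j | j in [set: I]].
Proof.
apply: ub_le_sup; last by exists i.
exists (\sum_j `|F j|) => _ [j _ <-]; rewrite (le_trans (ler_norm _))//.
by rewrite (bigD1 j)//= lerDl sumr_ge0.
Qed.

Theorem theorem3 (R : realType) (d M N : nat)
  (Omega GammaD GammaN : set 'rV[R]_d)
  (omega : 'I_N -> set 'rV[R]_d)
  (Gamma : 'I_M -> set 'rV[R]_d) (g : 'I_M -> 'rV[R]_d -> 'rV[R]_d)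
  (u : ('rV[R]_d -> R) -> ('rV[R]_d -> R) -> 'I_M -> H1 Omega)
  (K : constants R) :
  (d = 2 \/ d = 3)%N -> (0 < M)%N -> (0 < N)%N ->
  elastic_body Omega GammaD GammaN ->
  pixel_partition Omega omega ->
  boundary_loads GammaN Gamma g ->
  displacements GammaD GammaN g u ->
  valid_constants K ->
  let Lambda lam mu : 'M[R]_M := NtD Gamma g (u lam mu) in
  let LBmin : 'M[R]_M := Lambda (cst (lamBmin K)) (cst (muBmin K)) in
  let LBmax : 'M[R]_M := Lambda (cst (lamBmax K)) (cst (muBmax K)) in
  let kl : R := (cl K + lam0 K * epsl K) * (lamBmin K / lam_max K) in
  let km : R := (cm K + mu0 K * epsm K) * (muBmin K / mu_max K) in
  let T (s : 'I_N) : 'M[R]_M :=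
    LBmin + dNtD (u (cst (lamBmin K)) (cst (muBmin K)))
      (fun x => kl * \1_(omega s) x) (fun x => km * \1_(omega s) x) in
  let method (L : 'M[R]_M) : set 'rV[R]_d :=
    \bigcup_(s in [set s | mxge (T s + (delta K)%:M) L]) omega s in
  let nu : R := sup [set min_eig (T s - LBmax) | s in [set: 'I_N]] in
  lamBmax K < lamDmin K -> muBmax K < muDmin K ->
  nu < - 2 * delta K -> - 2 * delta K <= 0 ->
  resolution_guarantee (admissible Omega Lambda K) omega method.
Proof.
move=> _ _ _ [[_ _ oO] _ _ _] [omegaP _ _] loads disp valid.
move=> Lambda LBmin LBmax kl km T method nu _ _ nu_lt _ D.
case: valid => -[l0 m0] [el0 em0] [cl0 cm0] [lmax0 mmax0] [d0 lB0 mB0].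
move=> [[_ DO] [Plam Pmu] [onD offD] [bgnd contrast] [upper noise]].
have mO := measurable_open oO.
have lBmax0 : 0 < lamBmax K by rewrite mulr_gt0// ltr_pwDl.
have mBmax0 : 0 < muBmax K by rewrite mulr_gt0// ltr_pwDl.
have wBmin := disp _ _ (Linf_pos_cst Omega lB0) (Linf_pos_cst Omega mB0).
have wBmax := disp _ _ (Linf_pos_cst Omega lBmax0) (Linf_pos_cst Omega mBmax0).
have wD := disp _ _ Plam Pmu.
have offD_le x : Omega x -> ~ Defs.incl D x ->
    [/\ lamBmin K <= lam D x, lam D x <= lamBmax K,
        muBmin K <= mu D x & mu D x <= muBmax K].
  move=> Ox Dx; have [-> ->] := offD x (conj Ox Dx).
  have [] := bgnd x (conj Ox Dx).
  rewrite !ler_distl /lamBmin /lamBmax /muBmin /muBmax.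
  rewrite !mulrBr !mulrDr !mulr1.
  by move=> /andP[-> ->] /andP[-> ->].
have onD_ge x : Defs.incl D x ->
    lamBmin K + (cl K + lam0 K * epsl K) <= lam D x /\
    muBmin K + (cm K + mu0 K * epsm K) <= mu D x.
  move=> Dx; have [-> ->] := onD x Dx; have [] := contrast x Dx.
  by rewrite /lamBmin /muBmin; lra.
have kl0 : 0 <= cl K + lam0 K * epsl K by rewrite addr_ge0 ?mulr_ge0// ltW.
have km0 : 0 <= cm K + mu0 K * epsm K by rewrite addr_ge0 ?mulr_ge0// ltW.
have lower x : Omega x -> lamBmin K <= lam D x /\ muBmin K <= mu D x.
  move=> Ox; have [/onD_ge[]|/(offD_le x Ox)[]//] := pselect (Defs.incl D x).
  lra.
have blam : bounded_coef Omega (lam D).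
  split; first exact: Plam.1.1.
  exists (lam_max K) => x Ox; rewrite ger0_norm ?(upper x Ox).1//.
  exact: le_trans (ltW lB0) (lower x Ox).1.
have bmu : bounded_coef Omega (mu D).
  split; first exact: Pmu.1.1.
  exists (mu_max K) => x Ox; rewrite ger0_norm ?(upper x Ox).2//.
  exact: le_trans (ltW mB0) (lower x Ox).2.
have noise_le c := ler_normlP _ _ (mxform_le_spectral c noise).
split => [s sD|D0].
  apply: (@bigcup_sup _ _ s) => c /=; rewrite mxformD mxform_scalar.
  set hl := fun x => kl * \1_(omega s) x.
  set hm := fun x => km * \1_(omega s) x.
  have bhl : bounded_coef Omega hl := bounded_coef_indic _ _ (omegaP s).1.
  have bhm : bounded_coef Omega hm := bounded_coef_indic _ _ (omegaP s).1.
  have bl := bounded_coef_cst Omega (lamBmin K).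
  have bm := bounded_coef_cst Omega (muBmin K).
  (* The linear correction in T_s only changes the coefficients of the energy of
     the background displacements. *)
  have TE : (c^T *m T s *m c) 0 0 =
      (c^T *m energy_mx (fun x => lamBmin K - hl x) (fun x => muBmin K - hm x)
      (u (cst (lamBmin K)) (cst (muBmin K)))
      (u (cst (lamBmin K)) (cst (muBmin K))) *m c) 0 0.
    rewrite (energy_mxB mO _ _ bl bm bhl bhm) /T /LBmin /Lambda.
    rewrite (NtD_energy loads wBmin (fun k => (wBmin k).1)).
    rewrite mxformD mxform_tr mxformB; congr (_ + _).
    rewrite -mxformN; congr ((_ *m _ *m _) 0 0).
    by apply/matrixP => k l; rewrite !mxE.
  have := energy_mx_ge_NtD mO loads bl bm blam bmu (bounded_coefB bl bhl)
    (bounded_coefB bm bhm) wBmin wD.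
  move=> /(_ _ c); rewrite -TE.
  have [] := noise_le c; rewrite mxformB -/(Lambda _ _) => h1 h2 h3.
  suff /h3 : forall x, Omega x -> [/\ 0 < lam D x, 0 < mu D x,
      lamBmin K ^+ 2 <= (lamBmin K - hl x) * lam D x &
      muBmin K ^+ 2 <= (muBmin K - hm x) * mu D x].
    lra.
  move=> x Ox; have [lx mx] := lower x Ox; have [ux vx] := upper x Ox.
  split; [exact: lt_le_trans lx|exact: lt_le_trans mx| |].
  - by apply: pixel_weight => // /sD /onD_ge[].
  - by apply: pixel_weight => // /sD /onD_ge[].
rewrite -subset0 => x [s /= marked _].
suff : - 2 * delta K <= nu by rewrite leNgt nu_lt.
apply: le_trans (le_sup_finite (fun s => min_eig (T s - LBmax)) s).
apply: mxge_lb_min_eig; first by rewrite mulNr oppr_le0 mulr_ge0.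
(* Each of the two noise bounds, in the marking test and in the data, costs one
   delta. *)
move=> c; have := marked c; have [] := noise_le c.
have bl := bounded_coef_cst Omega (lamBmax K).
have bm := bounded_coef_cst Omega (muBmax K).
have := NtD_antimonotone mO loads blam bmu bl bm wD wBmax.
move=> /(_ _ c); rewrite -/(Lambda _ _) -/LBmax.
rewrite !mxformB !mxformD !mxform_scalar -/(Lambda _ _) => h1 h2 h3 h4.
suff /h1 : forall x, Omega x ->
    0 < lam D x <= lamBmax K /\ 0 < mu D x <= muBmax K.
  lra.
move=> y Oy; have [|] := offD_le y Oy; first by rewrite D0.
move=> ? -> ? ->; rewrite !andbT.
by split; [exact: lt_le_trans lB0 _|exact: lt_le_trans mB0 _].
Qed.
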